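(* Let $A:\mathcal{H}\to\mathcal{H}$ be an accretive bounded linear operator on a (real or complex) Hilbert space $\mathcal{H}$ with $\mathcal{R}(A)\neq\mathcal{H}$, and let $u\in\mathcal{H}$. If $P^\delta(u)=o(\delta^{1/2})$ as $\delta\to 0$, then $u=0$.
   Context: A bounded linear operator $A:\mathcal{H}\to\mathcal{H}$ on a real or complex Hilbert space is called accretive if $\mathrm{Re}\,\langle Au,u\rangle\ge 0$ for all $u\in\mathcal{H}$; then for every $\gamma>0$ the operator $A+\gamma I$ has a bounded inverse with $\|(A+\gamma I)^{-1}\|\le 1/\gamma$. $\mathcal{R}(A)$ denotes the range of $A$. For $u\in\mathcal{H}$ and $\delta>0$ the maximal best possible error of Lavrentiev regularization is $$P^\delta(u):=\sup_{f^\delta\in\mathcal{H}:\ \|Au-f^\delta\|\le\delta}\ \inf_{\gamma>0}\|(A+\gamma I)^{-1}f^\delta-u\|.$$ The limit $\delta\to 0$ is through positive values. *)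

(* Defs.v *)
From HB Require Import structures.
From mathcomp Require Import all_boot all_order all_algebra.
From mathcomp Require Import complex.
From mathcomp Require Import all_classical all_reals all_analysis.

Set Implicit Arguments.
Unset Strict Implicit.
Unset Printing Implicit Defensive.

Import Order.TTheory GRing.Theory Num.Theory.
Import numFieldNormedType.Exports.

Local Open Scope classical_set_scope.
Local Open Scope ring_scope.
Local Open Scope complex_scope.

Variant scalar_kind := RealScalars | ComplexScalars.

Definition scalar_field (R : realType) (k : scalar_kind) : numFieldType :=
  match k return numFieldType with
  | RealScalars => R
  | ComplexScalars => R[i]
  end.

Definition scalar_conj (R : realType) (k : scalar_kind) :
    scalar_field R k -> scalar_field R k :=
  match k return scalar_field R k -> scalar_field R k with
  | RealScalars => fun x => x
  | ComplexScalars => fun z : R[i] => z^*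
  end.

Definition scalar_re (R : realType) (k : scalar_kind) : scalar_field R k -> R :=
  match k return scalar_field R k -> R with
  | RealScalars => fun x => x
  | ComplexScalars => fun z : R[i] => complex.Re z
  end.

(* The norm of a normed module over R[i] takes its (real) values in R[i];
   hnorm is that value in R. *)
Definition hnorm (R : realType) (k : scalar_kind)
    (H : normedModType (scalar_field R k)) (v : H) : R :=
  scalar_re `|v|.

Definition induces_norm (R : realType) (k : scalar_kind)
    (H : normedModType (scalar_field R k)) (ip : {dot H for @scalar_conj R k}) : Prop :=
  forall v : H, ip v v = `|v| ^+ 2.

Definition accretive (R : realType) (k : scalar_kind)
    (H : normedModType (scalar_field R k)) (ip : {dot H for @scalar_conj R k})
    (A : H -> H) : Prop :=
  forall v : H, 0 <= scalar_re (ip (A v) v).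

Definition bounded_operator (R : realType) (k : scalar_kind)
    (H : normedModType (scalar_field R k)) (A : H -> H) : Prop :=
  exists M : R, forall v : H, hnorm (A v) <= M * hnorm v.

(* (A + g I)^-1. The inverse is genuine for the bounded accretive A on a
   Hilbert space and the g > 0 at which it is used; the default value 0 of
   pinv_ outside the range of A + g I then plays no role. *)
Definition resolvent (R : realType) (k : scalar_kind)
    (H : normedModType (scalar_field R k)) (A : H -> H) (g : scalar_field R k) : H -> H :=
  'pinv_(fun=> 0) [set: H] (fun v => A v + g *: v).

(* The parameter g ranges over the positive reals also for complex scalars,
   because 0 < g in R[i] forces g to be real. The infimum is over a nonempty
   set of nonnegative reals; as g -> +oo it is seen to be at most hnorm u, so
   that for 0 <= d the supremum is over a nonempty bounded set. *)
Definition max_best_error (R : realType) (k : scalar_kind)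
    (H : normedModType (scalar_field R k)) (A : H -> H) (u : H) (d : R) : R :=
  sup [set inf [set hnorm (resolvent A g f - u) | g in [set g | 0 < g]]
      | f in [set f | hnorm (A u - f) <= d]].

(* Main.v *)
Require Import Defs.
From HB Require Import structures.
From mathcomp Require Import all_boot all_order all_algebra.
From mathcomp Require Import all_classical all_reals all_analysis.
From mathcomp Require Import complex ring lra.

(* If A were bounded below it would be surjective: A + g is, by a contraction
   argument, for every g > 0, and a second contraction removes a small shift
   g. So there are unit vectors w with A w arbitrarily small; by accretivity w
   is then also almost orthogonal to the range of A, and w may be signed so
   that Re <u, w> <= 0. For the data A u + d w the error y solves (A + g) y =
   d w - g u. Pairing with w gives d <= (sqrt d + g) |y|; since |d w - g u| >=
   g |u|, also g |u| <= (|A| + g) |y|. Using the first bound for g <= sqrt d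
   and the second for g >= sqrt d shows that |y| is at least a constant times
   sqrt d for all g, and the constant is positive unless u = 0. *)

Set Implicit Arguments.
Unset Strict Implicit.
Unset Printing Implicit Defensive.

Import Order.TTheory GRing.Theory Num.Theory.
Import numFieldNormedType.Exports.

Local Open Scope classical_set_scope.
Local Open Scope ring_scope.

(** * Real scalars and real parts in either scalar field *)

Definition of_real (R : realType) (k : scalar_kind) : R -> scalar_field R k :=
  match k return R -> scalar_field R k with
  | RealScalars => fun x => x
  | ComplexScalars => fun x => (x%:C)%C
  end.
Arguments of_real {R} k.

Lemma scalar_reD (R : realType) k (x y : scalar_field R k) :
  scalar_re (x + y) = scalar_re x + scalar_re y.
Proof. by case: k x y => //= -[a b] [c d]. Qed.

Lemma scalar_reN (R : realType) k (x : scalar_field R k) :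
  scalar_re (- x) = - scalar_re x.
Proof. by case: k x => //= -[a b]. Qed.

Lemma scalar_reM_of_real (R : realType) k (r : R) (x : scalar_field R k) :
  scalar_re (of_real k r * x) = r * scalar_re x.
Proof. by case: k x => //= -[a b] /=; rewrite mul0r subr0. Qed.

Lemma of_realK (R : realType) k : cancel (@of_real R k) (@scalar_re R k).
Proof. by case: k. Qed.

Lemma of_real_gt0 (R : realType) k (r : R) : (0 < of_real k r) = (0 < r).
Proof. by case: k => //=; rewrite ltcR. Qed.

(** In [R[i]] comparable elements have equal imaginary parts, so a positive scalar is real. *)
Lemma scalar_reK_gt0 (R : realType) k (x : scalar_field R k) :
  0 < x -> of_real k (scalar_re x) = x.
Proof. by case: k x => //= -[a b]; rewrite ltcE /= => /andP[/eqP-> _]. Qed.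

Lemma scalar_re_ge0 (R : realType) k (x : scalar_field R k) :
  0 <= x -> 0 <= scalar_re x.
Proof. by case: k x => //= -[a b]; rewrite lecE /= => /andP[_]. Qed.

(** * The norm as a real number *)

Section RealifiedNorm.
Variables (R : realType) (k : scalar_kind).

Lemma ltr_of_real (a b : R) : (of_real k a < of_real k b) = (a < b).
Proof. by case: k => //=; rewrite ltcR. Qed.

Section NormedModule.
Variable H : normedModType (scalar_field R k).
Implicit Types v w : H.

Lemma norm_of_real v : `|v| = of_real k (hnorm v).
Proof.
rewrite /hnorm; have [->|v0] := eqVneq v 0.
  by rewrite normr0; case: k.
by rewrite scalar_reK_gt0 // normr_gt0.
Qed.

Lemma hnorm_ge0 v : 0 <= hnorm v.
Proof. exact/scalar_re_ge0/normr_ge0. Qed.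

Lemma hnorm0 : hnorm (0 : H) = 0.
Proof. by rewrite /hnorm normr0; case: k. Qed.

Lemma hnorm_eq0 v : hnorm v = 0 -> v = 0.
Proof.
by move=> v0; apply/normr0_eq0; rewrite norm_of_real v0; case: k.
Qed.

Lemma hnorm_opp v : hnorm (- v) = hnorm v.
Proof. by rewrite /hnorm normrN. Qed.

Lemma hnorm_distC v w : hnorm (v - w) = hnorm (w - v).
Proof. by rewrite /hnorm distrC. Qed.

Lemma ler_hnormD v w : hnorm (v + w) <= hnorm v + hnorm w.
Proof.
have := ler_normD v w; rewrite -subr_ge0 => /scalar_re_ge0.
by rewrite scalar_reD scalar_reN scalar_reD subr_ge0.
Qed.

Lemma hnorm_of_realZ (r : R) v : hnorm (of_real k r *: v) = `|r| * hnorm v.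
Proof.
rewrite /hnorm normrZ -scalar_reM_of_real; congr (scalar_re (_ * _)).
by case: k => //=; rewrite normc_def /= expr0n addr0 sqrtr_sqr.
Qed.

Lemma ballP_hnorm (v : H) (e : scalar_field R k) (w : H) : 0 < e ->
  ball v e w <-> hnorm (v - w) < scalar_re e.
Proof.
move=> e0.
by rewrite -ball_normE /= -{1}(scalar_reK_gt0 e0) norm_of_real ltr_of_real.
Qed.

End NormedModule.

(** * The contraction principle for the real-valued norm *)

Section Contraction.
Variable H : completeNormedModType (scalar_field R k).
Variables (F : H -> H) (q : R).
Hypotheses (q0 : 0 <= q) (q1 : q < 1).
Hypothesis Fq : forall x y, hnorm (F x - F y) <= q * hnorm (x - y).

Let a n := iter n F 0.
(** The solution of [B = q * B + hnorm (F 0)], so that the bound [B] passes from each iterate to the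
    next. *)
Let B := hnorm (F 0) / (1 - q).

Let a_bound m : hnorm (a m) <= B.
Proof.
have p0 : 0 < 1 - q by rewrite subr_gt0.
have B0 : 0 <= B by rewrite divr_ge0 ?hnorm_ge0 ?ltW.
elim: m => [|m IHm]; first by rewrite /a /= hnorm0.
rewrite /a /= -/(a m) -(subrK (F 0) (F (a m))).
apply: le_trans (ler_hnormD _ _) _.
have Fm := Fq (a m) 0; rewrite subr0 in Fm.
have -> : B = q * B + hnorm (F 0).
  have <- : B * (1 - q) = hnorm (F 0) by rewrite divfK ?lt0r_neq0.
  by ring.
by rewrite lerD2r (le_trans Fm) // ler_wpM2l.
Qed.

Let a_dist n m : hnorm (a (n + m) - a n) <= q ^+ n * B.
Proof.
elim: n => [|n IHn].
  by rewrite expr0 mul1r add0n {2}/a /= subr0.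
rewrite addSn /a /= -/(a (n + m)) -/(a n) exprS -mulrA.
by rewrite (le_trans (Fq _ _)) // ler_wpM2l.
Qed.

Let a_cauchy (e : R) : 0 < e ->
  exists n, forall m, (n <= m)%N -> hnorm (a n - a m) < e.
Proof.
move=> e0; have B1 : 0 < B + 1.
  by rewrite ltr_wpDl // (le_trans (hnorm_ge0 _) (a_bound 0)).
have qn : q ^+ n @[n --> \oo] --> 0 by apply: cvg_expr; rewrite ger0_norm.
have /cvgrPdist_lt/(_ (e / (B + 1))) := qn.
rewrite divr_gt0 // => /(_ isT)[n _ /(_ n (leqnn n))] /=.
rewrite sub0r normrN ger0_norm ?exprn_ge0 // ltr_pdivlMr // => qe.
exists n => m nm; rewrite hnorm_distC -(subnKC nm).
apply: le_lt_trans (a_dist _ _) (le_lt_trans _ qe).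
by rewrite ler_wpM2l ?exprn_ge0 // lerDl.
Qed.

Lemma hnorm_contraction_fixpoint : exists x, F x = x.
Proof.
have : cvg (a @ \oo).
  apply/cauchy_cvgP/cauchy_exP => e e0.
  have re0 : 0 < scalar_re e by rewrite -(of_real_gt0 k) scalar_reK_gt0.
  have [n an] := a_cauchy re0; exists (a n); exists n => // m /= nm.
  by apply/ballP_hnorm => //; apply: an.
move=> ca; set p := lim (a @ \oo); exists p.
have ap (e : R) : 0 < e -> exists2 n, hnorm (p - a n) < e & hnorm (p - a n.+1) < e.
  move=> e0; have ek : 0 < of_real k e by rewrite of_real_gt0.
  have /cvg_ball/(_ _ ek)[n _ pn] := ca.
  exists n; rewrite -[e](of_realK k); apply/ballP_hnorm => //; apply: pn => /=.
    exact: leqnn.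
  exact: leqnSn.
apply/eqP; rewrite -subr_eq0; apply/eqP/hnorm_eq0/eqP.
rewrite eq_le hnorm_ge0 andbT; apply/ler_addgt0Pr => e e0; rewrite add0r.
have [n n1 n2] := ap (e / 2) (divr_gt0 e0 (ltr0Sn _ 1)).
(* [F (a n)] is [a n.+1], which is close to [p]; [F p] is close to it by contraction. *)
rewrite -[F p - p](subrKA (F (a n))).
apply: le_trans (ler_hnormD _ _) _; rewrite (splitr e) lerD //.
  rewrite (le_trans (Fq _ _)) // (le_trans _ (ltW n1)) //.
  by rewrite ler_piMl ?hnorm_ge0 // ltW.
by rewrite hnorm_distC ltW.
Qed.
End Contraction.
End RealifiedNorm.

(** * Cauchy-Schwarz inequalities from discriminants *)

Lemma discriminant_le (R : realFieldType) (a b c : R) : 0 <= c ->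
  (forall r, 0 <= a + r * b *+ 2 + r ^+ 2 * c) -> b ^+ 2 <= a * c.
Proof.
rewrite le_eqVlt => /predU1P[<-|c0] abc.
  have [->|b0] := eqVneq b 0; first by rewrite mulr0 expr0n.
  (* For [c = 0] and [b != 0] the polynomial is affine and takes the value [-1] here. *)
  have := abc (- (a + 1) / (b *+ 2)); rewrite mulr0 addr0 -mulrnAr divfK.
    by rewrite opprD addNKr oppr_ge0 ler10.
  by rewrite mulrn_eq0.
(* The minimiser of the quadratic. *)
have := abc (- b / c).
rewrite (_ : _ + _ = a - b ^+ 2 / c); last by field; rewrite gt_eqF.
by rewrite subr_ge0 ler_pdivrMr.
Qed.

Section RealInnerProduct.
Variables (R : realType) (k : scalar_kind) (H : normedModType (scalar_field R k)).
Variable ip : {dot H for @scalar_conj R k}.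
Hypothesis ip_norm : induces_norm ip.
Implicit Types x y z : H.

Definition re_ip x y : R := scalar_re (ip x y).

Lemma re_ipDl x y z : re_ip (x + y) z = re_ip x z + re_ip y z.
Proof. by rewrite /re_ip linearDl scalar_reD. Qed.

Lemma re_ipZl (r : R) x y : re_ip (of_real k r *: x) y = r * re_ip x y.
Proof. by rewrite /re_ip linearZl_LR scalar_reM_of_real. Qed.

Lemma re_ipC x y : re_ip x y = re_ip y x.
Proof.
rewrite /re_ip; have -> : ip x y = (-1) ^+ false * scalar_conj (ip y x).
  by case: ip => [f [? ? [herm]]]; exact: herm.
by rewrite expr0 mul1r; case: k (ip y x) => //= -[].
Qed.

Lemma re_ipDr x y z : re_ip x (y + z) = re_ip x y + re_ip x z.
Proof. by rewrite re_ipC re_ipDl !(re_ipC x). Qed.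

Lemma re_ipZr (r : R) x y : re_ip x (of_real k r *: y) = r * re_ip x y.
Proof. by rewrite re_ipC re_ipZl re_ipC. Qed.

Lemma re_ipNl x y : re_ip (- x) y = - re_ip x y.
Proof. by rewrite /re_ip linearNl scalar_reN. Qed.

Lemma re_ipNr x y : re_ip x (- y) = - re_ip x y.
Proof. by rewrite re_ipC re_ipNl re_ipC. Qed.

Lemma re_ip_sqr x : re_ip x x = hnorm x ^+ 2.
Proof.
rewrite /re_ip ip_norm norm_of_real expr2 scalar_reM_of_real of_realK.
by rewrite expr2.
Qed.

Lemma re_ip_le x y : re_ip x y <= hnorm x * hnorm y.
Proof.
suff : re_ip x y ^+ 2 <= (hnorm x * hnorm y) ^+ 2.
  move=> xy; rewrite (le_trans (ler_norm _)) //.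
  rewrite -(ler_pXn2r (n := 2)) ?nnegrE ?mulr_ge0 ?hnorm_ge0 //.
  by rewrite real_normK ?num_real.
rewrite exprMn; apply: discriminant_le => [|r]; first exact: sqr_ge0.
have -> : hnorm x ^+ 2 + r * re_ip x y *+ 2 + r ^+ 2 * hnorm y ^+ 2 =
    re_ip (x + of_real k r *: y) (x + of_real k r *: y).
  rewrite !(re_ipDl, re_ipDr, re_ipZl, re_ipZr) !re_ip_sqr (re_ipC y).
  by ring.
by rewrite re_ip_sqr sqr_ge0.
Qed.

Variable A : {linear H -> H}.
Hypothesis A_accretive : accretive ip A.

(** The quadratic [r |-> Re <A (x + r y), x + r y>] is nonnegative. Since [A] need not be symmetric,
    its linear coefficient is a sum of two terms; doubling the quadratic avoids halving that sum. *)
Lemma accretive_cauchy_schwarz x y :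
  (re_ip (A x) y + re_ip (A y) x) ^+ 2 <= 4 * re_ip (A x) x * re_ip (A y) y.
Proof.
set a := re_ip (A x) x; set c := re_ip (A y) y.
rewrite (_ : 4 * a * c = (a *+ 2) * (c *+ 2)); last by ring.
apply: discriminant_le => [|r]; first by rewrite mulrn_wge0 // A_accretive.
have := A_accretive (x + of_real k r *: y); rewrite -/(re_ip _ _).
rewrite linearD linearZ !(re_ipDl, re_ipDr, re_ipZl, re_ipZr) -/a -/c => h.
rewrite (_ : _ + _ = (a + r * re_ip (A y) x +
  (r * re_ip (A x) y + r * (r * c))) *+ 2) ?mulrn_wge0 //.
  by rewrite -mulrDr.
move: a c (re_ip _ _) (re_ip _ _) {h} => a c p q.
by ring.
Qed.

End RealInnerProduct.

(** * Norm estimates for [A + g] *)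

Section BoundedAccretive.
Variables (R : realType) (k : scalar_kind).
Variable H : normedModType (scalar_field R k).
Variable ip : {dot H for @scalar_conj R k}.
Hypothesis ip_norm : induces_norm ip.
Variable A : {linear H -> H}.
Hypothesis A_accretive : accretive ip A.
Variable M : R.
Hypotheses (M0 : 0 <= M) (A_bound : forall v, hnorm (A v) <= M * hnorm v).
Implicit Types (g : R) (u v w y f : H).

Let re_ipE := (@re_ipDl _ _ _ ip, @re_ipDr _ _ _ ip,
  @re_ipZl _ _ _ ip, @re_ipZr _ _ _ ip,
  @re_ipNl _ _ _ ip, @re_ipNr _ _ _ ip, re_ip_sqr ip_norm).

Lemma hnormB_sqr v w :
  hnorm (v - w) ^+ 2 = hnorm v ^+ 2 - re_ip ip v w *+ 2 + hnorm w ^+ 2.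
Proof. by rewrite -(re_ip_sqr ip_norm) !re_ipE (re_ipC ip w v); ring. Qed.

Lemma hnorm_shift_le g v : 0 <= g ->
  hnorm (A v + of_real k g *: v) <= (M + g) * hnorm v.
Proof.
move=> g0; rewrite (le_trans (ler_hnormD _ _)) // hnorm_of_realZ ger0_norm //.
by rewrite mulrDl lerD2r A_bound.
Qed.

Lemma re_ip_shift_ge g v :
  g * hnorm v ^+ 2 <= re_ip ip (A v + of_real k g *: v) v.
Proof. by rewrite !re_ipE lerDr A_accretive. Qed.

Lemma hnorm_shift_ge g v : g * hnorm v <= hnorm (A v + of_real k g *: v).
Proof.
have [v0|v0] := eqVneq (hnorm v) 0; first by rewrite v0 mulr0 hnorm_ge0.
have vp : 0 < hnorm v by rewrite lt_def v0 hnorm_ge0.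
rewrite -(ler_pM2r vp) -mulrA -expr2.
exact: le_trans (re_ip_shift_ge g v) (re_ip_le ip_norm _ _).
Qed.

(** The cross term [2 g Re <A v, v>] of the expanded square is nonnegative. A lower bound for [A]
    thus passes to its shifts. *)
Lemma hnorm_le_shift g v : 0 <= g ->
  hnorm (A v) <= hnorm (A v + of_real k g *: v).
Proof.
move=> g0; rewrite -(ler_pXn2r (n := 2)) ?nnegrE ?hnorm_ge0 //.
rewrite -(re_ip_sqr ip_norm (_ + _)) !re_ipE (re_ipC ip v).
have := mulr_ge0 g0 (A_accretive v); rewrite -/(re_ip _ _ _).
have := sqr_ge0 (g * hnorm v); rewrite exprMn => h1 h2.
by rewrite mulrA -expr2; nra.
Qed.

(* v |-> v - t (A v + g v - f) contracts for t = g / (M + g)^2, because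
   |v - t B v|^2 <= (1 - 2 t g + t^2 (M + g)^2) |v|^2 for B = A + g. *)
Definition shift_step g : R := g / (M + g) ^+ 2.
Definition shift_rate g : R := Num.sqrt (1 - (g / (M + g)) ^+ 2).

Lemma shift_step_gt0 g : 0 < g -> 0 < shift_step g.
Proof. by move=> g0; rewrite divr_gt0 ?exprn_gt0 ?ltr_wpDl. Qed.

Lemma shift_rate_lt1 g : 0 < g -> shift_rate g < 1.
Proof.
move=> g0; rewrite -[ltRHS]sqrtr1 ltr_sqrt // gtrBl exprn_gt0 // divr_gt0 //.
by rewrite ltr_wpDl.
Qed.

Lemma shift_contracts g v : 0 < g ->
  hnorm (v - of_real k (shift_step g) *: (A v + of_real k g *: v)) <=
    shift_rate g * hnorm v.
Proof.
move=> g0; have t0 := shift_step_gt0 g0; rewrite /shift_rate.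
set t := shift_step g in t0 *; set B := A v + _.
have L0 : 0 < M + g by rewrite ltr_wpDl.
have r0 : 0 <= 1 - (g / (M + g)) ^+ 2.
  rewrite subr_ge0 exprn_ile1 //; first by rewrite divr_ge0 // ltW.
  by rewrite ler_pdivrMr // mul1r lerDr.
rewrite -(ler_pXn2r (n := 2)) ?nnegrE ?mulr_ge0 ?hnorm_ge0 ?sqrtr_ge0 //.
rewrite exprMn sqr_sqrtr // hnormB_sqr re_ipZr hnorm_of_realZ gtr0_norm //.
have Bv1 := re_ip_shift_ge g v; have Bv2 := hnorm_shift_le v (ltW g0).
rewrite -/B (re_ipC ip _ v) in Bv1; rewrite -/B in Bv2.
have Bv3 : hnorm B ^+ 2 <= (M + g) ^+ 2 * hnorm v ^+ 2.
  by rewrite -exprMn ler_pXn2r ?nnegrE ?hnorm_ge0 // mulr_ge0 ?hnorm_ge0 // ltW.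
rewrite -(ler_pM2l t0) in Bv1; rewrite -(ler_pM2l (exprn_gt0 2 t0)) in Bv3.
(* With [rho = (g / (M + g)) ^+ 2], the linear term contributes [-2 rho] and the quadratic one at
   most [rho], which leaves [1 - rho]. *)
have e1 : t * g = (g / (M + g)) ^+ 2.
  by rewrite /t /shift_step; field; rewrite gt_eqF.
have e2 : t ^+ 2 * (M + g) ^+ 2 = (g / (M + g)) ^+ 2.
  by rewrite /t /shift_step; field; rewrite gt_eqF.
rewrite (mulrA t g) e1 in Bv1; rewrite (mulrA _ ((M + g) ^+ 2)) e2 in Bv3.
by rewrite exprMn; lra.
Qed.

End BoundedAccretive.

(** * Surjectivity and the resolvent *)

Section Resolvent.
Variables (R : realType) (k : scalar_kind).
Variable H : completeNormedModType (scalar_field R k).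
Variable ip : {dot H for @scalar_conj R k}.
Hypothesis ip_norm : induces_norm ip.
Variable A : {linear H -> H}.
Hypothesis A_accretive : accretive ip A.
Variable M : R.
Hypotheses (M0 : 0 <= M) (A_bound : forall v, hnorm (A v) <= M * hnorm v).
Implicit Types (g : R) (f : H).

Lemma shift_surjective g f : 0 < g -> exists v, A v + of_real k g *: v = f.
Proof.
move=> g0; have t0 := shift_step_gt0 M0 g0; set t := shift_step M g in t0.
have [|x y|v] := @hnorm_contraction_fixpoint R k H
    (fun v => v - of_real k t *: (A v + of_real k g *: v - f)) (shift_rate M g)
    (sqrtr_ge0 _).
- exact: shift_rate_lt1.
- have := shift_contracts ip_norm A_accretive M0 A_bound (x - y) g0.
  congr (hnorm _ <= _); rewrite opprD addrACA -opprD -scalerBr.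
  rewrite opprB addrA subrK opprD addrACA -linearB.
  by rewrite -scalerBr.
- move=> /eqP; rewrite -subr_eq0 addrAC subrr add0r oppr_eq0 scaler_eq0.
  case/orP=> [/eqP t'|]; first by move: t0; rewrite -(of_real_gt0 k) t' ltxx.
  by rewrite subr_eq0 => /eqP; exists v.
Qed.

(** Let [S] solve the equation shifted by [c / 2]. A fixed point of [v |-> S (f + (c / 2) v)]
    satisfies [A v = f]; the shifted operator is still bounded below by [c], so the map contracts
    with rate [1 / 2]. *)
Lemma bounded_below_surjective (c : R) : 0 < c ->
  (forall v, c * hnorm v <= hnorm (A v)) -> range A = [set: H].
Proof.
move=> c0 Ac; have g0 : 0 < c / 2 by rewrite divr_gt0.
have [S SK] := choice (fun f => shift_surjective f g0).
rewrite -subTset => f _.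
have [| |x y|v vE] := @hnorm_contraction_fixpoint R k H
    (fun v => S (f + of_real k (c / 2) *: v)) 2^-1.
- by rewrite invr_ge0.
- by rewrite invf_lt1 ?ltr1n.
- set d := S _ - S _.
  have dE : A d + of_real k (c / 2) *: d = of_real k (c / 2) *: (x - y).
    rewrite /d linearB scalerBr addrACA -opprD !SK opprD addrACA.
    by rewrite subrr add0r scalerBr.
  have := le_trans (Ac d) (hnorm_le_shift ip_norm A_accretive d (ltW g0)).
  by rewrite dE hnorm_of_realZ gtr0_norm // -mulrA ler_pM2l.
- exists v => //; have := SK (f + of_real k (c / 2) *: v).
  by rewrite vE => /addIr.
Qed.

Lemma resolventK (g : scalar_field R k) f : 0 < g ->
  A (resolvent A g f) + g *: resolvent A g f = f.
Proof.
move=> g0; apply: (@pinvK _ _ _ _ (fun v => A v + g *: v)).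
rewrite inE /=.
have gr0 : 0 < scalar_re g by rewrite -(of_real_gt0 k) scalar_reK_gt0.
have [v vE] := shift_surjective f gr0.
by exists v => //; rewrite -vE scalar_reK_gt0.
Qed.

Lemma hnorm_resolvent_le (g : scalar_field R k) f : 0 < g ->
  scalar_re g * hnorm (resolvent A g f) <= hnorm f.
Proof.
move=> g0.
have := hnorm_shift_ge ip_norm A_accretive (scalar_re g) (resolvent A g f).
by rewrite scalar_reK_gt0 // resolventK.
Qed.

End Resolvent.

(** * Lower bound for the regularization error *)

Section LowerBound.
Variables (R : realType) (k : scalar_kind).
Variable H : normedModType (scalar_field R k).
Variable ip : {dot H for @scalar_conj R k}.
Hypothesis ip_norm : induces_norm ip.
Variable A : {linear H -> H}.
Hypothesis A_accretive : accretive ip A.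
Variable M : R.
Hypotheses (M0 : 0 <= M) (A_bound : forall v, hnorm (A v) <= M * hnorm v).
Implicit Types (g c eta d : R) (u v w y : H).

(** Normalise [v], then change its sign if needed; the first two clauses do not see the sign. *)
Lemma unit_vector_toward u v : v != 0 -> exists w,
  [/\ hnorm w = 1, hnorm v * hnorm (A w) = hnorm (A v) & re_ip ip u w <= 0].
Proof.
move=> v0; have vp : 0 < hnorm v.
  by rewrite lt_def hnorm_ge0 andbT; apply: contra_neq v0 => /hnorm_eq0.
pose w := of_real k (hnorm v)^-1 *: v.
have w1 : hnorm w = 1.
  by rewrite hnorm_of_realZ ger0_norm ?invr_ge0 ?hnorm_ge0 // mulVf ?gt_eqF.
have Aw : hnorm v * hnorm (A w) = hnorm (A v).
  rewrite /w linearZ hnorm_of_realZ ger0_norm ?invr_ge0 ?hnorm_ge0 //.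
  by rewrite mulVKf ?gt_eqF.
have [uw|uw] := leP (re_ip ip u w) 0; first by exists w.
by exists (- w); rewrite linearN !hnorm_opp re_ipNr oppr_le0 ltW.
Qed.

(* For accretive A, an approximate null vector of A is one of its adjoint too,
   by Cauchy-Schwarz for the form Re <Ax, y> + Re <Ay, x>. *)
Lemma re_ip_approx_null c eta w y : hnorm w = 1 -> hnorm (A w) <= c ->
  0 <= eta -> 2 * c <= eta -> 16 * M * c <= eta ^+ 2 ->
  re_ip ip (A y) w <= eta * hnorm y.
Proof.
move=> w1 Aw eta0 ceta Mc.
have CS := accretive_cauchy_schwarz A_accretive y w.
have Ay : re_ip ip (A y) y <= M * hnorm y ^+ 2.
  rewrite (le_trans (re_ip_le ip_norm _ _)) // expr2 mulrA.
  by rewrite ler_wpM2r ?hnorm_ge0.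
have Aww : re_ip ip (A w) w <= c.
  by rewrite (le_trans (re_ip_le ip_norm _ _)) // w1 mulr1.
have Awy : - re_ip ip (A w) y <= c * hnorm y.
  rewrite -re_ipNl (le_trans (re_ip_le ip_norm _ _)) // hnorm_opp.
  by rewrite ler_wpM2r ?hnorm_ge0.
have Ay0 : 0 <= re_ip ip (A y) y := A_accretive y.
have Aw0 : 0 <= re_ip ip (A w) w := A_accretive w.
have y0 := hnorm_ge0 y.
(* [16 * M * c <= eta ^+ 2] says that [4 * M * c] is at most the square of [eta / 2]. The other half
   of [eta] absorbs [- Re <A w, y>], by [2 * c <= eta]. *)
have half : re_ip ip (A y) w + re_ip ip (A w) y <= eta / 2 * hnorm y.
  rewrite (le_trans (ler_norm _)) //.
  rewrite -(ler_pXn2r (n := 2)) ?nnegrE ?mulr_ge0 ?divr_ge0 //.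
  rewrite real_normK ?num_real // (le_trans CS) //.
  have := ler_pM Ay0 Aw0 Ay Aww; have := ler_wpM2r (sqr_ge0 (hnorm y)) Mc.
  move: (re_ip _ _ _) (re_ip _ _ _) (hnorm y) => p q n.
  by move=> h1 h2; nra.
have := ler_wpM2r y0 ceta.
move: half Awy; move: (re_ip _ _ _) (re_ip _ _ _) (hnorm y) => p q n.
by lra.
Qed.

(* Pairing (A + g) y with w bounds y from below by noise over eta + g; expanding
   the norm of d w - g u bounds it by the bias.  The sign of Re <u, w> rules out
   cancellation between noise and bias. *)
Lemma error_lower_bound d g u w y : 0 < d <= 1 -> 0 < g ->
  hnorm w = 1 -> re_ip ip u w <= 0 ->
  re_ip ip (A y) w <= Num.sqrt d * hnorm y ->
  A y + of_real k g *: y = of_real k d *: w - of_real k g *: u ->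
  Num.sqrt d * Num.min 2^-1 (hnorm u / (M + 1)) <= hnorm y.
Proof.
move=> /andP[d0 d1] g0 w1 uw Ayw yE.
set s := Num.sqrt d in Ayw *.
have s0 : 0 < s by rewrite sqrtr_gt0.
have s1 : s <= 1 by rewrite -[leRHS]sqrtr1 ler_wsqrtr.
have sd : s ^+ 2 = d by rewrite sqr_sqrtr // ltW.
have noise : d <= (s + g) * hnorm y.
  have : re_ip ip (A y + of_real k g *: y) w <= (s + g) * hnorm y.
    rewrite re_ipDl re_ipZl mulrDl lerD // ler_wpM2l ?(ltW g0) //.
    by rewrite (le_trans (re_ip_le ip_norm _ _)) // w1 mulr1.
  rewrite yE re_ipDl re_ipNl !re_ipZl re_ip_sqr // w1 expr1n mulr1.
  by apply: le_trans; rewrite lerDl oppr_ge0 mulr_ge0_le0 // ltW.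
have bias : g * hnorm u <= (M + g) * hnorm y.
  rewrite (le_trans _ (hnorm_shift_le A_bound y (ltW g0))) // yE.
  rewrite -(ler_pXn2r (n := 2)) ?nnegrE ?mulr_ge0 ?hnorm_ge0 ?(ltW g0) //.
  rewrite (hnormB_sqr ip_norm) !hnorm_of_realZ !gtr0_norm // w1.
  rewrite re_ipZl re_ipZr (re_ipC ip w).
  have : d * (g * re_ip ip u w) <= 0.
    by rewrite pmulr_rle0 // pmulr_rle0.
  by have := sqr_ge0 d; rewrite mulr1; lra.
have M1 : 0 < M + 1 by rewrite ltr_wpDl.
have y0 := hnorm_ge0 y; have u0 := hnorm_ge0 u.
(* If [g <= s], the noise bound gives [s ^+ 2 <= 2 * s * hnorm y]. *)
have [gs|sg] := leP g s.
  apply: (@le_trans _ _ (s * 2^-1)).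
    by rewrite ler_pM2l // ge_min lexx.
  rewrite -(ler_pM2l s0); rewrite -sd in noise.
  by nra.
apply: (@le_trans _ _ (s * (hnorm u / (M + 1)))).
  by rewrite ler_pM2l // ge_min lexx orbT.
rewrite mulrA ler_pdivrMr //.
rewrite -(ler_pM2l g0).
have : s * (g * hnorm u) <= s * ((M + g) * hnorm y) by rewrite ler_pM2l.
(* Termwise: [s * M <= g * M] as [s < g], and [s * g <= g] as [s <= 1], which is where [d <= 1]
   enters. *)
have : s * (M + g) <= g * (M + 1).
  by rewrite !mulrDr lerD // ?ler_wpM2r ?(ltW sg) // mulrC ler_pM2l.
move=> /(ler_wpM2r y0).
by lra.
Qed.

End LowerBound.

(** * From the error bound to the maximal best error *)

Lemma bounded_operator_nonneg (R : realType) k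
    (H : normedModType (scalar_field R k)) (A : H -> H) :
  bounded_operator A ->
  exists2 M, 0 <= M & forall v, hnorm (A v) <= M * hnorm v.
Proof.
move=> [M AM]; exists `|M| => [|v]; first exact: normr_ge0.
by rewrite (le_trans (AM v)) // ler_wpM2r ?hnorm_ge0 // ler_norm.
Qed.

Lemma max_best_error_ge (R : realType) k
    (H : completeNormedModType (scalar_field R k))
    (ip : {dot H for @scalar_conj R k}) (A : {linear H -> H}) (u f : H) (d m : R) :
  induces_norm ip -> bounded_operator A -> accretive ip A ->
  hnorm (A u - f) <= d ->
  (forall g, 0 < g -> m <= hnorm (resolvent A g f - u)) ->
  m <= max_best_error A u d.
Proof.
move=> ip_norm /bounded_operator_nonneg[M M0 AM] A_accretive fd mE.
pose err f' := [set hnorm (resolvent A g f' - u) |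
  g in [set g : scalar_field R k | 0 < g]].
have err_mem f' : err f' (hnorm (resolvent A 1 f' - u)).
  by exists 1 => //=; exact: ltr01.
have m_inf : m <= inf (err f).
  apply: lb_le_inf; first by exists (hnorm (resolvent A 1 f - u)).
  by move=> _ [g g0 <-]; apply: mE.
apply: le_trans m_inf _; apply: ub_le_sup; last by exists f.
(* The real [sup] dominates its members only if the set is bounded above. Each infimum is at most
   its value at [g = 1], where the resolvent does not increase norms. *)
exists (hnorm (A u) + d + hnorm u) => _ [f' f'd <-].
apply: (@le_trans _ _ (hnorm (resolvent A 1 f' - u))).
  by apply: ge_inf (err_mem f'); exists 0 => _ [g _ <-]; exact: hnorm_ge0.
rewrite (le_trans (ler_hnormD _ _)) // hnorm_opp lerD2r.
have := hnorm_resolvent_le ip_norm A_accretive M0 AM f' (ltr01).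
rewrite (_ : scalar_re 1 = 1) ?mul1r; last by case: (k).
move=> /le_trans; apply; rewrite -[f'](subKr (A u)).
by rewrite (le_trans (ler_hnormD _ _)) // hnorm_opp lerD2l.
Qed.

Theorem theorem5p1 (R : realType) (k : scalar_kind)
    (H : completeNormedModType (scalar_field R k))
    (ip : {dot H for @scalar_conj R k})
    (ip_norm : induces_norm ip)
    (A : {linear H -> H}) (A_bounded : bounded_operator A)
    (A_accretive : accretive ip A) (A_range : range A <> [set: H])
    (u : H)
    (P_littleo : (max_best_error A u : R -> R^o) =o_ (0^'+)
      (@Num.sqrt R : R -> R^o)) :
  u = 0.
Proof.
have [M M0 AM] := bounded_operator_nonneg A_bounded.
apply/eqP; apply: contrapT => /negP u0.
have M1 : 0 < M + 1 by rewrite ltr_wpDl.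
pose m := Num.min 2^-1 (hnorm u / (M + 1)).
have m0 : 0 < m.
  rewrite lt_min invr_gt0 ltr0n divr_gt0 // lt_def hnorm_ge0 andbT.
  by apply: contra_neq u0 => /hnorm_eq0.
have P_ge d : 0 < d <= 1 -> Num.sqrt d * m <= max_best_error A u d.
  move=> d01; have /andP[d0 d1] := d01.
  (* The two entries are the smallness conditions of [re_ip_approx_null] for [eta = Num.sqrt d];
     [M + 1] avoids division by zero. *)
  pose c := Num.min (Num.sqrt d / 2) (d / (16 * (M + 1))).
  have s0 : 0 < Num.sqrt d by rewrite sqrtr_gt0.
  have c0 : 0 < c by rewrite lt_min !divr_gt0 ?mulr_gt0.
  have [v Av] : exists v, hnorm (A v) < c * hnorm v.
    apply: contrapT => nA; apply: A_range.
    apply: (bounded_below_surjective ip_norm A_accretive M0 AM c0) => v.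
    by rewrite leNgt; apply/negP => Av; apply: nA; exists v.
  have v0 : v != 0.
    by apply: contraTneq Av => ->; rewrite linear0 hnorm0 mulr0 ltxx.
  have [w [w1 Aw uw]] := unit_vector_toward ip A u v0.
  have Awc : hnorm (A w) <= c.
    have v1 : 0 < hnorm v.
      by rewrite lt_def hnorm_ge0 andbT; apply: contra_neq v0 => /hnorm_eq0.
    by rewrite -(ler_pM2l v1) Aw mulrC ltW.
  apply: (max_best_error_ge (f := A u + of_real k d *: w) ip_norm) => //.
    by rewrite opprD addNKr hnorm_opp hnorm_of_realZ w1 mulr1 gtr0_norm.
  move=> g g0; have gr0 : 0 < scalar_re g.
    by rewrite -(of_real_gt0 k) scalar_reK_gt0.
  apply: (error_lower_bound ip_norm M0 AM d01 gr0 w1 uw).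
    apply: (re_ip_approx_null ip_norm A_accretive AM _ w1 Awc (ltW s0)).
      by rewrite mulrC -ler_pdivlMr // ge_min lexx.
    rewrite sqr_sqrtr ?(ltW d0) //.
    apply: (@le_trans _ _ (16 * (M + 1) * c)).
      by rewrite ler_pM2r // ler_pM2l // lerDl.
    by rewrite mulrC -ler_pdivlMr ?mulr_gt0 // ge_min lexx orbT.
  (* For the data [A u + d w], applying [A + g] to the error leaves [d w - g u]. *)
  rewrite scalar_reK_gt0 // linearB scalerBr addrACA.
  rewrite (resolventK ip_norm A_accretive M0 AM _ g0).
  by rewrite addrACA subrr add0r.
(* Any constant below [m] contradicts [P_ge] at a small [d]. *)
have /eqoP/(_ (m / 2)) := P_littleo.
rewrite divr_gt0 // => /(_ isT) P_small.
near (0 : R)^'+ => d.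
have d0 : 0 < d by near: d; exact: nbhs_right_gt.
have d1 : d <= 1 by near: d; exact: nbhs_right_le.
have : `|max_best_error A u d| <= m / 2 * `|Num.sqrt d| by near: d.
apply/negP; rewrite -ltNge (lt_le_trans _ (ler_norm _)) //.
apply: lt_le_trans (P_ge d _); last by rewrite d0.
rewrite ger0_norm ?sqrtr_ge0 // mulrC ltr_pM2l ?sqrtr_gt0 //.
by rewrite ltr_pdivrMr // mulr_natr mulr2n ltrDl.
Unshelve. all: by end_near.
Qed.
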